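(* Let $A\in\mathbb{H}^n_{++}$ and let $P\in\mathbb{H}^n_{++}$ be a preconditioner. Let $x$ be the solution of $Ax=b$ and let $x_k$ be the $k$-th iterate of the preconditioned conjugate gradient method applied to $Ax=b$ with preconditioner $P$ and initial guess $x_0$. For every positive even integer $k$ such that $$3\,\mathcal{D}_{\mathrm{LD}}(A,P)\le k<n$$ we have $$\|x_k-x\|_A \le \Big(\frac{3\,\mathcal{D}_{\mathrm{LD}}(A,P)}{k}\Big)^{k/2}\,\|x_0-x\|_A.$$
   Context: $\mathbb{H}^n_{++}$ denotes the set of $n\times n$ Hermitian positive definite matrices. For $A,P\in\mathbb{H}^n_{++}$ the Bregman log determinant divergence is $$\mathcal{D}_{\mathrm{LD}}(A,P) = \operatorname{tr}(AP^{-1}) - \ln\det(AP^{-1}) - n.$$ For $H\in\mathbb{H}^n_{++}$, $\|v\|_H=(v^*Hv)^{1/2}$. Preconditioned conjugate gradient method (PCG) for $Ax=b$ with preconditioner $P$, $H=P^{-1}$, and initial guess $x_0$: $r_0=b-Ax_0$, $p_0=Hr_0$, and for $k=0,1,2,\dots$ $$\alpha_k=\frac{r_k^*Hr_k}{p_k^*Ap_k},\quad x_{k+1}=x_k+\alpha_kp_k,\quad r_{k+1}=r_k-\alpha_kAp_k,\quad \beta_k=\frac{r_{k+1}^*Hr_{k+1}}{r_k^*Hr_k},\quad p_{k+1}=Hr_{k+1}+\beta_kp_k.$$ If $r_k=0$ the iteration stops, and by convention $r_j=0$ and $x_j=x_k$ for all $j\ge k$. *)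

(* Defs.v *)
From HB Require Import structures.
From mathcomp Require Export all_boot all_order all_algebra.
From mathcomp Require Export reals exp.
From mathcomp.real_closed Require Export complex.

Set Implicit Arguments.
Unset Strict Implicit.
Unset Printing Implicit Defensive.

Import GRing.Theory Order.TTheory Num.Theory.
Local Open Scope ring_scope.
Local Open Scope complex_scope.
Local Open Scope sesquilinear_scope.

Definition qform (R : realType) (n : nat) (H : 'M[R[i]]_n) (v : 'cV[R[i]]_n) :
    R[i] :=
  (v ^t* *m H *m v) ord0 ord0.

(* [0 < z] in R[i] means that z is real and positive. *)
Definition hposdef (R : realType) (n : nat) (H : 'M[R[i]]_n) : Prop :=
  H \is hermsymmx /\ forall v : 'cV[R[i]]_n, v != 0 -> 0 < qform H v.

(* [v^* H v] is real and nonnegative for positive definite H, so that [Re] only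
   casts it to R. *)
Definition hnorm (R : realType) (n : nat) (H : 'M[R[i]]_n)
    (v : 'cV[R[i]]_n) : R :=
  Num.sqrt (complex.Re (qform H v)).

(* For A, P positive definite, A P^-1 is similar to the positive definite matrix
   P^-1/2 A P^-1/2: its trace is real and its determinant is real and positive,
   so that [Re] only casts them to R. *)
Definition logdet_div (R : realType) (n : nat) (A P : 'M[R[i]]_n) : R :=
  complex.Re (\tr (A *m invmx P)) - ln (complex.Re (\det (A *m invmx P)))
  - n%:R.

Record pcg_state (R : realType) (n : nat) := PCGState {
  pcg_x : 'cV[R[i]]_n;
  pcg_r : 'cV[R[i]]_n;
  pcg_p : 'cV[R[i]]_n }.

Definition pcg_init (R : realType) (n : nat) (A P : 'M[R[i]]_n)
    (b x0 : 'cV[R[i]]_n) : pcg_state R n :=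
  let r0 := b - A *m x0 in
  PCGState x0 r0 (invmx P *m r0).

(* Once the residual vanishes, the state is left unchanged. *)
Definition pcg_step (R : realType) (n : nat) (A P : 'M[R[i]]_n)
    (s : pcg_state R n) : pcg_state R n :=
  let H := invmx P in
  let: PCGState x r p := s in
  if r == 0 then s else
  let alpha := qform H r / qform A p in
  let r' := r - alpha *: (A *m p) in
  let beta := qform H r' / qform H r in
  PCGState (x + alpha *: p) r' (H *m r' + beta *: p).

Definition pcg (R : realType) (n : nat) (A P : 'M[R[i]]_n)
    (b x0 : 'cV[R[i]]_n) (k : nat) : pcg_state R n :=
  iter k (pcg_step A P) (pcg_init A P b x0).

Definition pcg_iterate (R : realType) (n : nat) (A P : 'M[R[i]]_n)
    (b x0 : 'cV[R[i]]_n) (k : nat) : 'cV[R[i]]_n :=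
  pcg_x (pcg A P b x0 k).

(* Main.v *)
From mathcomp Require Import lra ring zify sequences.
Require Import Defs.

Set Implicit Arguments.
Unset Strict Implicit.
Unset Printing Implicit Defensive.

Import GRing.Theory Order.TTheory Num.Theory.
Local Open Scope ring_scope.
Local Open Scope sesquilinear_scope.

(** Factor P = G^* G and A = G^* diag(lam) G simultaneously
    ([simultaneous_diag]).  The lam i > 0 are the eigenvalues of P^-1 A, and
    the divergence D becomes the sum of phi(lam i) with
    phi(x) = x - 1 - ln x >= 0 ([logdet_div_pencil]).

    The k-th iterate minimises the A-norm of the error over x0 + K_k, K_k the
    Krylov space of P^-1 A ([pcg_optimal]).  Hence the error is at most that of
    q(P^-1 A)(x0 - x) for any polynomial q of degree at most k with q(0) = 1,
    that is, at most max_i |q(lam i)| times the initial error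
    ([hnorm_filter]).

    With k = 2m, take for the roots of q the m smallest eigenvalues a_j and the
    m largest ones b_j ([deflating_roots]).  At these eigenvalues q vanishes;
    at any other eigenvalue x, a_j <= x <= b_j for every j, and the pair of
    factors for j satisfies
      |(1 - x/a_j) (1 - x/b_j)| <= y_j - 1,
      y_j = (a_j + b_j)^2 / (4 a_j b_j).
    The bound ln s <= s - 1 at the mean s of a_j and b_j gives
    ln y_j <= phi(a_j) + phi(b_j), so the t_j = ln y_j >= 0 add up to at most
    D.  As t |-> ln (e^t - 1) is concave, the product of the e^t_j - 1 is at
    most (e^u - 1)^m with u = D / m, and u <= 2/3 gives
    e^u - 1 <= 3u/2 = 3D/k ([prod_expRB1_le]). *)

(** * Exponential inequalities *)

(** Bernoulli's inequality z^c >= 1 + c (z - 1) at z = e^w.  Both the chord and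
    the tangent bounds for the exponential below are instances of it. *)
Lemma expR_bernoulli (R : realType) (c w : R) :
  1 <= c -> 1 + c * (expR w - 1) <= expR (c * w).
Proof.
move=> c1.
have hw : expR w * (1 - w) <= 1.
  have := expR_ge1Dx (- w); rewrite -(ler_pM2l (expR_gt0 w)).
  by rewrite expRxMexpNx_1.
have -> : c * w = w + (c - 1) * w by ring.
rewrite expRD; have h := expR_ge1Dx ((c - 1) * w).
have h2 : expR w * (1 + (c - 1) * w) <= expR w * expR ((c - 1) * w).
  by rewrite ler_pM2l ?expR_gt0.
apply: le_trans h2; rewrite -subr_ge0.
have -> : expR w * (1 + (c - 1) * w) - (1 + c * (expR w - 1))
  = (c - 1) * (1 - expR w * (1 - w)) by ring.
by apply: mulr_ge0; rewrite subr_ge0.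
Qed.

Lemma expR_two_thirds (R : realType) : expR (2 / 3 : R) <= 2.
Proof.
(* e^(-2/27) >= 25/27, and 2 (25/27)^9 >= 1. *)
have h : (25 / 27 : R) <= expR (- (2 / 27)).
  by apply: le_trans (expR_ge1Dx _); lra.
have -> : 2 / 3 = 9%:R * (2 / 27) :> R by field.
rewrite expRM_natl -[2 / 27]opprK expRN exprVn.
rewrite invf_ple ?posrE ?exprn_gt0 ?expR_gt0//.
apply: (@le_trans _ _ ((25 / 27 : R) ^+ 9)); first by lra.
by apply: lerXn2r; rewrite // nnegrE ?expR_ge0//; lra.
Qed.

(** By convexity e^u - 1 lies below its chord over [0, 2/3], whose slope is at
    most 3/2 because e^(2/3) <= 2. *)
Lemma expRB1_chord (R : realType) (u : R) :
  0 < u -> u <= 2 / 3 -> expR u - 1 <= 3 / 2 * u.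
Proof.
move=> u0 u1.
have c1 : 1 <= 2 / 3 / u by rewrite ler_pdivlMr// mul1r.
have := expR_bernoulli u c1; rewrite divfK ?gt_eqF//.
move=> /le_trans/(_ (expR_two_thirds R)) h.
have {h} : 2 / 3 / u * (expR u - 1) <= 1 by lra.
rewrite -mulrA [_^-1 * _]mulrC mulrA ler_pdivrMr// mul1r; lra.
Qed.

(** The concave function t |-> ln (e^t - 1) lies below its tangent at u, of
    slope e^u / (e^u - 1); both sides are exponentiated, so that t need not be
    positive. *)
Lemma expRB1_tangent (R : realType) (u t : R) : 0 < u ->
  expR t - 1 <= (expR u - 1) * expR (expR u / (expR u - 1) * (t - u)).
Proof.
move=> u0; have e1 : 0 < expR u - 1 by rewrite subr_gt0 expR_gt1.
have c1 : 1 <= expR u / (expR u - 1) by rewrite ler_pdivlMr// mul1r gerBl ler01.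
have := expR_bernoulli (t - u) c1; rewrite -(ler_pM2l e1).
apply: le_trans; rewrite mulrDr mulr1 mulrA mulrCA divff ?gt_eqF// mulr1.
by rewrite mulrBr -expRD [u + _]addrC subrK; lra.
Qed.

(** Jensen's inequality for the concave function t |-> ln (e^t - 1) at the mean
    u = D / #|I|, followed by the chord bound.  Multiplying the tangent bounds at
    u makes the exponents add up to a nonpositive number. *)
Lemma prod_expRB1_le (R : realType) (I : finType) (t : I -> R) (D : R) :
  (0 < #|I|)%N -> (forall j, 0 <= t j) -> \sum_j t j <= D ->
  D <= 2 / 3 * #|I|%:R ->
  \prod_j (expR (t j) - 1) <= (3 / 2 * (D / #|I|%:R)) ^+ #|I|.
Proof.
move=> m0 t0 tD Dm; set m : R := #|I|%:R; set u := D / m.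
have m_gt0 : 0 < m by rewrite ltr0n.
have um : u * m = D by rewrite divfK// gt_eqF.
have D0 : 0 <= D by apply: le_trans tD; apply: sumr_ge0.
have : 0 <= u by rewrite divr_ge0// ltW.
rewrite le0r => /orP[/eqP u0|u0].
  (* No tangent exists at u = 0, but then every factor vanishes. *)
  have tz j : t j = 0.
    move: tD; rewrite -um u0 mul0r => tD.
    have /eqP : \sum_j t j = 0 by apply/eqP; rewrite eq_le tD sumr_ge0.
    by rewrite psumr_eq0// => /allP/(_ j (mem_index_enum _))/eqP.
  move/card_gt0P: m0 => [j _].
  by rewrite (bigD1 j)//= tz expR0 subrr mul0r u0 mulr0 exprn_ge0.
have u1 : u <= 2 / 3 by rewrite ler_pdivrMr.
set c := expR u / (expR u - 1).
have e1 : 0 < expR u - 1 by rewrite subr_gt0 expR_gt1.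
have c0 : 0 <= c by rewrite divr_ge0 ?expR_ge0// ltW.
apply: (@le_trans _ _ (\prod_(j : I) ((expR u - 1) * expR (c * (t j - u))))).
  apply: ler_prod => j _; rewrite subr_ge0 expRB1_tangent// andbT.
  by rewrite -expR0 ler_expR.
rewrite big_split/= prodr_const -expR_sum -mulr_sumr sumrB sumr_const.
have -> : u *+ #|I| = D by rewrite -um mulr_natr.
apply: (@le_trans _ _ ((expR u - 1) ^+ #|I|)).
  rewrite ler_piMr ?exprn_ge0 ?(ltW e1)// -expR0 ler_expR.
  by rewrite mulr_ge0_le0// subr_le0.
apply: lerXn2r; rewrite ?nnegrE ?(ltW e1)//; last exact: expRB1_chord.
by move: u0 => /=; lra.
Qed.

(** * Choice of the roots *)

Definition logdet_term (R : realType) (x : R) : R := x - 1 - ln x.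

Lemma logdet_term_ge0 (R : realType) (x : R) : 0 < x -> 0 <= logdet_term x.
Proof.
move=> x0; rewrite subr_ge0.
have := @le_ln1Dx R (x - 1).
have -> : 1 + (x - 1) = x by ring.
by apply; lra.
Qed.

(** The squared ratio of the arithmetic to the geometric mean of a and b. *)
Definition mean_ratio (R : realType) (a b : R) : R :=
  (a + b) ^+ 2 / (4 * (a * b)).

Lemma mean_ratio_ge1 (R : realType) (a b : R) :
  0 < a -> 0 < b -> 1 <= mean_ratio a b.
Proof.
move=> a0 b0; have ab := mulr_gt0 a0 b0.
rewrite ler_pdivlMr ?mul1r; last lra.
rewrite -subr_ge0; have -> : (a + b) ^+ 2 - 4 * (a * b) = (a - b) ^+ 2 by ring.
exact: sqr_ge0.
Qed.

(** The mean ratio is s^2 / (a b) for the arithmetic mean s = (a + b) / 2, and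
    the difference of the two sides is twice [logdet_term s]. *)
Lemma ln_mean_ratio_le (R : realType) (a b : R) : 0 < a -> 0 < b ->
  ln (mean_ratio a b) <= logdet_term a + logdet_term b.
Proof.
move=> a0 b0; set s := (a + b) / 2; have s0 : 0 < s by rewrite /s; lra.
have -> : mean_ratio a b = s ^+ 2 / (a * b).
  by rewrite /mean_ratio /s; field; rewrite !gt_eqF.
have sE : s + s = a + b by rewrite /s; field.
clearbody s.
rewrite ln_div ?posrE ?exprn_gt0 ?mulr_gt0// lnXn// lnM ?posrE// mulr2n.
have := logdet_term_ge0 s0; rewrite /logdet_term; lra.
Qed.

(** On [a, b] the quadratic with roots a and b and value 1 at 0 is extremal at
    the midpoint, where it equals 1 - (a + b)^2 / (4 a b). *)
Lemma norm_pair_le (R : realType) (a b x : R) : 0 < a -> a <= x -> x <= b ->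
  `|(1 - x / a) * (1 - x / b)| <= mean_ratio a b - 1.
Proof.
move=> a0 ax xb; have b0 : 0 < b by lra.
have ab : 0 < a * b by rewrite mulr_gt0.
have -> : (1 - x / a) * (1 - x / b) = - ((x - a) * (b - x) / (a * b)).
  by field; rewrite !gt_eqF.
rewrite normrN ger0_norm; last first.
  by rewrite divr_ge0 ?(ltW ab)// mulr_ge0// subr_ge0.
have -> : mean_ratio a b - 1 = (b - a) ^+ 2 / 4 / (a * b).
  by rewrite /mean_ratio; field; rewrite !gt_eqF.
rewrite ler_pM2r ?invr_gt0// -subr_ge0.
have -> : (b - a) ^+ 2 / 4 - (x - a) * (b - x) = ((a + b) / 2 - x) ^+ 2 by field.
exact: sqr_ge0.
Qed.

Lemma sum_ends_le (R : numDomainType) (f : nat -> R) (n m : nat) :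
  (forall t, (t < n)%N -> 0 <= f t) -> (m.*2 <= n)%N ->
  \sum_(j < m) (f j + f (n.-1 - j)%N) <= \sum_(0 <= t < n) f t.
Proof.
move=> f0 mn.
rewrite (@big_cat_nat _ _ _ m)//=; last by lia.
rewrite (@big_cat_nat _ _ _ (n - m) m)//=; [|lia|lia].
rewrite big_split/= big_mkord lerD2l.
have -> : \sum_(j < m) f (n.-1 - j)%N = \sum_(n - m <= t < n) f t.
  rewrite -{1}[(n - m)%N]add0n big_addn subKn; last by lia.
  rewrite big_nat_rev big_mkord; apply: eq_bigr => j _; congr f.
  by have := ltn_ord j; lia.
rewrite lerDr big_nat_cond; apply: sumr_ge0 => t /andP[/andP[_ t1] _].
by apply: f0; lia.
Qed.

(** The j-th smallest number is paired with the j-th largest: every pair then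
    encloses all the numbers that are not roots, and the pairs occupy distinct
    positions in the family, so that together they cost at most D. *)
Lemma deflating_roots (R : realType) (n m : nat) (lam : 'I_n -> R) :
  let D := \sum_i logdet_term (lam i) in
  (forall i, 0 < lam i) -> (0 < m)%N -> (m.*2 <= n)%N ->
  D <= 2 / 3 * m%:R ->
  exists2 s : seq R, size s = m.*2 &
    forall i, `|\prod_(mu <- s) (1 - lam i / mu)| <= (3 / 2 * (D / m%:R)) ^+ m.
Proof.
move=> D lam0 m0 mn Dm.
set ls := sort <=%O [seq lam i | i <- enum 'I_n].
have sz : size ls = n by rewrite size_sort size_map size_enum_ord.
have ls_perm : perm_eq ls [seq lam i | i <- enum 'I_n] by rewrite perm_sort.
have ls0 t : (t < n)%N -> 0 < nth 0 ls t.
  rewrite -sz => /(mem_nth 0); rewrite (perm_mem ls_perm) => /mapP[i _ ->].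
  exact: lam0.
have ls_mono t t' : (t <= t')%N -> (t' < n)%N -> nth 0 ls t <= nth 0 ls t'.
  move=> tt' t'n; apply: le_sorted_leq_nth => //.
  - exact: sort_le_sorted.
  - by rewrite inE sz; apply: leq_ltn_trans t'n.
  - by rewrite inE sz.
pose a (j : 'I_m) := nth 0 ls j.
pose b (j : 'I_m) := nth 0 ls (n.-1 - j).
have a0 j : 0 < a j by apply: ls0; have := ltn_ord j; lia.
have b0 j : 0 < b j by apply: ls0; have := ltn_ord j; lia.
have y1 j : 1 <= mean_ratio (a j) (b j) by exact: mean_ratio_ge1.
have sum_le : \sum_(j < m) ln (mean_ratio (a j) (b j)) <= D.
  have -> : D = \sum_(0 <= t < n) logdet_term (nth 0 ls t).
    rewrite -sz -(big_nth 0 xpredT (@logdet_term R)).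
    by rewrite (perm_big _ ls_perm)/= big_map big_enum.
  apply: le_trans (@sum_ends_le _ _ n m _ mn); last first.
    by move=> t /ls0/logdet_term_ge0.
  by apply: ler_sum => j _; apply: ln_mean_ratio_le.
have prod_le : \prod_(j < m) (mean_ratio (a j) (b j) - 1)
    <= (3 / 2 * (D / m%:R)) ^+ m.
  have := @prod_expRB1_le R 'I_m (fun j => ln (mean_ratio (a j) (b j))) D.
  rewrite card_ord => /(_ m0 (fun j => ln_ge0 (y1 j)) sum_le Dm).
  apply: le_trans; apply: ler_prod => j _.
  by rewrite lnK ?posrE ?lexx ?andbT ?subr_ge0 ?(lt_le_trans ltr01).
exists ([seq a j | j <- enum 'I_m] ++ [seq b j | j <- enum 'I_m]).
  by rewrite size_cat (size_map a) (size_map b) size_enum_ord addnn.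
move=> i; rewrite big_cat/= (big_map a) (big_map b) !big_enum/= -big_split/=.
apply: le_trans prod_le; rewrite normr_prod.
have [t tn ->] : exists2 t, (t < n)%N & lam i = nth 0 ls t.
  have : lam i \in ls by rewrite (perm_mem ls_perm) map_f// mem_enum.
  by move=> /(nthP 0)[t]; rewrite sz => tn <-; exists t.
(* t is the rank of the i-th number in increasing order. *)
have [/andP[mt tm]|] := boolP ((m <= t) && (t < n - m))%N.
  apply: ler_prod => j _; rewrite normr_ge0/=.
  by apply: norm_pair_le; rewrite // ls_mono//; have := ltn_ord j; lia.
move=> out; rewrite [X in X <= _](_ : _ = 0).
  by apply: prodr_ge0 => j _; rewrite subr_ge0.
have [tm|mt] := ltnP t m.
  rewrite (bigD1 (Ordinal tm))//= /a/= divff ?gt_eqF ?ls0//.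
  by rewrite subrr mul0r normr0 mul0r.
have tm : (n.-1 - t < m)%N by lia.
rewrite (bigD1 (Ordinal tm))//= /b/= subKn ?divff ?gt_eqF ?ls0//; last by lia.
by rewrite subrr mulr0 normr0 mul0r.
Qed.

(** * Hermitian forms and Krylov spaces *)

Section Sesquilinear.
Variables (C : numClosedFieldType) (n : nat).
Implicit Types (M : 'M[C]_n) (u v w : 'cV[C]_n) (c : C).

Definition cdot u v : C := (u ^t* *m v) ord0 ord0.

Lemma cdotDr u v w : cdot u (v + w) = cdot u v + cdot u w.
Proof. by rewrite /cdot mulmxDr mxE. Qed.

Lemma cdotZr c u v : cdot u (c *: v) = c * cdot u v.
Proof. by rewrite /cdot -scalemxAr mxE. Qed.

Lemma cdot0r u : cdot u 0 = 0.
Proof. by rewrite /cdot mulmx0 mxE. Qed.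

Lemma cdotC u v : cdot v u = (cdot u v)^*.
Proof.
by rewrite /cdot -[in LHS](trmxCK u) -map_mxM -trmx_mul !mxE.
Qed.

Lemma cdot_adj M u v : cdot u (M *m v) = cdot (M ^t* *m u) v.
Proof. by rewrite /cdot trmx_mul map_mxM trmxCK mulmxA. Qed.

Lemma cdotDl u v w : cdot (u + v) w = cdot u w + cdot v w.
Proof. by rewrite cdotC cdotDr rmorphD /= -!cdotC. Qed.

Lemma cdotZl c u v : cdot (c *: u) v = c^* * cdot u v.
Proof. by rewrite cdotC cdotZr rmorphM /= -cdotC. Qed.

Lemma cdot_herm M u v : M ^t* = M -> cdot (M *m u) v = cdot u (M *m v).
Proof. by move=> hM; rewrite cdot_adj hM. Qed.

(** Pythagoras: d and e are orthogonal for the form M, so that d can only add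
    energy to e. *)
Lemma energy_orth_le M d e : M ^t* = M -> 0 <= cdot d (M *m d) ->
  cdot e (M *m d) = 0 -> cdot e (M *m e) <= cdot (d + e) (M *m (d + e)).
Proof.
move=> hM d0 ed.
have -> : cdot (d + e) (M *m (d + e)) =
    cdot d (M *m d) + cdot d (M *m e) + (cdot e (M *m d) + cdot e (M *m e)).
  by rewrite mulmxDr !cdotDl !cdotDr.
have de : cdot d (M *m e) = 0 by rewrite -cdot_herm// cdotC ed conjC0.
by rewrite ed de addr0 add0r lerDr.
Qed.

Definition herm_posdef M := M ^t* = M /\ forall v, v != 0 -> 0 < cdot v (M *m v).

(** The span of z, M z, ..., M^(k-1) z, generated by Horner's scheme: the
    vectors p(M) z with p of degree less than k. *)
Fixpoint krylov M z k v : Prop :=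
  if k is k'.+1 then exists c w, krylov M z k' w /\ v = c *: z + M *m w
  else v = 0.

Section Krylov.
Variables (M : 'M[C]_n) (z : 'cV[C]_n).
Local Notation K := (krylov M z).

Lemma krylov0 k : K k 0.
Proof.
elim: k => //= k IH; exists 0, 0; split=> //.
by rewrite scale0r mulmx0 addr0.
Qed.

Lemma krylovD k v w : K k v -> K k w -> K k (v + w).
Proof.
elim: k v w => [|k IH] v w /= => [-> ->|]; first by rewrite addr0.
move=> [c1 [w1 [K1 ->]]] [c2 [w2 [K2 ->]]].
exists (c1 + c2), (w1 + w2); split; first exact: IH.
by rewrite scalerDl mulmxDr addrACA.
Qed.

Lemma krylovZ k a v : K k v -> K k (a *: v).
Proof.
elim: k v => [|k IH] v /= => [->|]; first by rewrite scaler0.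
move=> [c [w [Kw ->]]]; exists (a * c), (a *: w); split; first exact: IH.
by rewrite scalerDr scalerA -scalemxAr.
Qed.

Lemma krylovB k v w : K k v -> K k w -> K k (v - w).
Proof. by move=> Kv Kw; rewrite -scaleN1r; apply/krylovD/krylovZ. Qed.

Lemma krylovM k v : K k v -> K k.+1 (M *m v).
Proof. by move=> Kv; exists 0, v; rewrite scale0r add0r. Qed.

Lemma krylovS k v : K k v -> K k.+1 v.
Proof.
elim: k v => [|k IH] v; first by move=> ->; apply: krylov0.
by move=> [c [w [Kw ->]]]; exists c, w; split; first exact: IH.
Qed.

Lemma krylov_start k : K k.+1 z.
Proof.
by exists 1, 0; rewrite scale1r mulmx0 addr0; split=> //; apply: krylov0.
Qed.
End Krylov.

(** With q the product of the 1 - X / mu for mu in s, the fold is q(M) e, and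
    q(M) e - e has no constant term because q(0) = 1. *)
Lemma krylov_filter M z e (s : seq C) : M *m e = - z ->
  krylov M z (size s) (foldr (fun mu v => v - mu^-1 *: (M *m v)) e s - e).
Proof.
move=> Me; elim: s => [|mu s IH]; first by rewrite subrr.
rewrite [foldr _ _ _]/=.
set v := foldr _ _ _ in IH *.
rewrite addrAC; apply: krylovB; first exact: krylovS.
apply: krylovZ; rewrite -(subrK e v) mulmxDr Me -[- z]scaleN1r.
by apply: krylovD; [apply: krylovM|apply/krylovZ/krylov_start].
Qed.

End Sesquilinear.

(** * Simultaneous diagonalization *)

Section Diagonalization.
Variables (C : numClosedFieldType) (n : nat).
Implicit Types (M A P : 'M[C]_n).

Lemma congruence_herm_posdef M G : G \in unitmx -> herm_posdef M ->
  herm_posdef (G ^t* *m M *m G).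
Proof.
move=> uG [hM M0]; split; first by rewrite !trmx_mul !map_mxM trmxCK hM mulmxA.
move=> v v0; rewrite -!mulmxA cdot_adj trmxCK; apply: M0.
by apply: contraNneq v0 => Gv; rewrite -(mulKmx uG v) Gv mulmx0.
Qed.

Lemma invmx_adj M : (invmx M) ^t* = invmx (M ^t*).
Proof. by rewrite trmx_inv map_invmx. Qed.

Lemma unitmx_adj M : (M ^t* \in unitmx) = (M \in unitmx).
Proof. by rewrite map_unitmx unitmx_tr. Qed.

(** The spectral theorem; an eigenvalue is the value of the form at a unit
    eigenvector, hence positive. *)
Lemma herm_posdef_diag M : herm_posdef M ->
  exists2 U, U \in unitmx & exists2 d : 'rV_n,
    (forall i, 0 < d 0 i) & U ^t* *m U = 1%:M /\ M = U ^t* *m diag_mx d *m U.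
Proof.
move=> [hM M0].
have hsM : M \is hermsymmx by apply/is_hermitianmxP; rewrite expr0 scale1r hM.
have /orthomx_spectralP ME := hermitian_normalmx hsM.
set U := spectralmx M in ME; set d := spectral_diag M in ME.
have Uu : U \is unitarymx := spectral_unitarymx M.
have uU : U \in unitmx := unitarymx_unit Uu.
rewrite invmx_unitary// in ME.
have UU : U ^t* *m U = 1%:M by rewrite -invmx_unitary// mulVmx.
have UU' : U *m U ^t* = 1%:M by rewrite -invmx_unitary// mulmxV.
exists U => //; exists d => // i.
pose e : 'cV[C]_n := delta_mx i 0.
have Uee : U *m (U ^t* *m e) = e by rewrite mulmxA UU' mul1mx.
have v0 : U ^t* *m e != 0.
  apply: contraTneq isT => Ue; move: Uee; rewrite Ue mulmx0 => /matrixP/(_ i 0).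
  by rewrite !mxE !eqxx => /esym/eqP; rewrite oner_eq0.
have := M0 _ v0; rewrite ME -!mulmxA Uee cdot_adj trmxCK Uee.
suff -> : cdot e (diag_mx d *m e) = d 0 i by [].
rewrite /cdot mul_diag_mx mxE (bigD1 i)//= !mxE !eqxx conjC1 mulr1 mul1r.
by rewrite big1 ?addr0// => j ji; rewrite !mxE (negbTE ji) conjC0 mul0r.
Qed.

Lemma diag_mx_unit (d : 'rV[C]_n) : (forall i, 0 < d 0 i) -> diag_mx d \in unitmx.
Proof.
move=> d0; rewrite unitmxE det_diag unitfE.
by apply/prodf_neq0 => i _; rewrite gt_eqF.
Qed.

Lemma adj_diag_mx (d : 'rV[C]_n) : (forall i, 0 < d 0 i) ->
  (diag_mx d) ^t* = diag_mx d.
Proof.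
move=> d0; rewrite tr_diag_mx map_diag_mx; congr diag_mx.
by apply/rowP => i; rewrite !mxE; apply/CrealP/gtr0_real.
Qed.

Lemma herm_posdef_factor P : herm_posdef P ->
  exists2 G, G \in unitmx & P = G ^t* *m G.
Proof.
case/herm_posdef_diag=> U uU [d d0 [_ ->]].
pose s : 'rV[C]_n := map_mx sqrtC d.
have s0 i : 0 < s 0 i by rewrite mxE sqrtC_gt0.
exists (diag_mx s *m U); first by rewrite unitmx_mul diag_mx_unit.
rewrite trmx_mul map_mxM adj_diag_mx// !mulmxA; congr (_ *m _).
rewrite -!mulmxA; congr (_ *m _); rewrite mulmx_diag; congr diag_mx.
by apply/rowP => i; rewrite !mxE -expr2 sqrtCK.
Qed.

(** Factor P = F^* F, then diagonalize F^-* A F^-1 by a unitary U: as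
    U^* U = 1, the product G = U F still factors P. *)
Lemma simultaneous_diag A P : herm_posdef A -> herm_posdef P ->
  exists2 G, G \in unitmx & exists2 d : 'rV_n,
    (forall i, 0 < d 0 i) & P = G ^t* *m G /\ A = G ^t* *m diag_mx d *m G.
Proof.
move=> hA /herm_posdef_factor[F uF ->].
have uFi : invmx F \in unitmx by rewrite unitmx_inv.
have [U uU [d d0 [UU BE]]] := herm_posdef_diag (congruence_herm_posdef uFi hA).
exists (U *m F); first by rewrite unitmx_mul uU.
exists d => //; rewrite trmx_mul map_mxM; split.
  by rewrite -[RHS]mulmxA [U ^t* *m _]mulmxA UU mul1mx.
have -> : F ^t* *m U ^t* *m diag_mx d *m (U *m F)
    = F ^t* *m (U ^t* *m diag_mx d *m U) *m F by rewrite !mulmxA.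
rewrite -BE invmx_adj -!mulmxA mulVmx// mulmx1 mulKVmx//.
by rewrite unitmx_adj.
Qed.

Lemma invmx_herm_posdef P : herm_posdef P -> herm_posdef (invmx P).
Proof.
move=> hP; have [G uG PE] := herm_posdef_factor hP.
have uP : P \in unitmx by rewrite PE unitmx_mul unitmx_adj uG.
have -> : invmx P = (invmx P) ^t* *m P *m invmx P.
  by rewrite invmx_adj hP.1 mulVmx// mul1mx.
by apply: congruence_herm_posdef; rewrite ?unitmx_inv.
Qed.

Section Pencil.
Variables (A P G : 'M[C]_n) (d : 'rV[C]_n).
Hypotheses (uG : G \in unitmx) (PE : P = G ^t* *m G)
  (AE : A = G ^t* *m diag_mx d *m G).

Let uG' : G ^t* \in unitmx. Proof. by rewrite unitmx_adj. Qed.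

Lemma pencil_invmx : invmx P = invmx G *m invmx (G ^t*).
Proof.
have uP : P \in unitmx by rewrite PE unitmx_mul uG'.
apply: (can_inj (mulKmx uP)); rewrite mulmxV// PE.
by rewrite -mulmxA mulKVmx// mulmxV.
Qed.

Lemma pencil_trace : \tr (A *m invmx P) = \sum_i d 0 i.
Proof.
rewrite AE pencil_invmx -!mulmxA mulKVmx// mxtrace_mulC -mulmxA mulVmx//.
by rewrite mulmx1 mxtrace_diag.
Qed.

Lemma pencil_det : \det (A *m invmx P) = \prod_i d 0 i.
Proof.
rewrite AE pencil_invmx -!mulmxA mulKVmx// !det_mulmx det_diag mulrCA -det_mulmx.
by rewrite mulmxV// det1 mulr1.
Qed.

(** In the coordinates given by G, P^-1 A is diagonal, so that a polynomial in
    it acts on each coordinate separately. *)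
Lemma pencil_filter (s : seq C) (e : 'cV[C]_n) (i : 'I_n) :
  (G *m foldr (fun mu v => v - mu^-1 *: (invmx P *m A *m v)) e s) i 0
  = \prod_(mu <- s) (1 - d 0 i / mu) * (G *m e) i 0.
Proof.
elim: s => [|mu s IH]; first by rewrite big_nil mul1r.
rewrite [foldr _ _ _]/= big_cons -mulrA -IH; move: (foldr _ _ _) => v.
have -> : G *m (v - mu^-1 *: (invmx P *m A *m v))
  = G *m v - mu^-1 *: (diag_mx d *m (G *m v)).
  rewrite [LHS]mulmxBr -scalemxAr; congr (_ - _ *: _).
  by rewrite pencil_invmx AE -!mulmxA mulKVmx// mulKmx.
by move: (G *m v) => w; rewrite mul_diag_mx !mxE; ring.
Qed.

Lemma pencil_energy v :
  cdot v (A *m v) = \sum_i d 0 i * `|(G *m v) i 0| ^+ 2.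
Proof.
rewrite AE -!mulmxA cdot_adj trmxCK /cdot mul_diag_mx mxE.
by apply: eq_bigr => i _; rewrite !mxE normCK; ring.
Qed.

End Pencil.
End Diagonalization.

(** * Optimality of the iterates *)

Local Open Scope complex_scope.
Arguments krylov : simpl never.

Section PCG.
Variables (R : realType) (n : nat) (A P : 'M[R[i]]_n) (b x0 : 'cV[R[i]]_n).
Local Notation H := (invmx P).
Hypotheses (hA : herm_posdef A) (hH : herm_posdef H).
Local Notation K := (krylov (H *m A) (H *m (b - A *m x0))).

Lemma qformE (M : 'M[R[i]]_n) v : qform M v = cdot v (M *m v).
Proof. by rewrite /qform /cdot mulmxA. Qed.

(** The search direction p_k is P^-1 r_k corrected by an element of K_k so as to
    be A-orthogonal to K_k; [pcg_inv_span] says that it completes K_k to K_(k+1).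
    Stating orthogonality to the whole of K_k, instead of to the earlier residuals
    and directions, makes the invariant inductive without any reference to the
    previous states. *)
Record pcg_inv k (s : pcg_state R n) : Prop := PCGInv {
  pcg_inv_res : pcg_r s = b - A *m pcg_x s;
  pcg_inv_x : K k (pcg_x s - x0);
  pcg_inv_r : K k.+1 (H *m pcg_r s);
  pcg_inv_p : K k (pcg_p s - H *m pcg_r s);
  pcg_inv_orth : forall v, K k v -> cdot (pcg_r s) v = 0;
  pcg_inv_conj : forall v, K k v -> cdot (pcg_p s) (A *m v) = 0;
  pcg_inv_span : forall v, K k.+1 v -> exists c, K k (v - c *: pcg_p s) }.

Lemma pcg_inv_init : pcg_inv 0 (pcg_init A P b x0).
Proof.
split=> //=; rewrite ?subrr//.
- exact: (krylov_start _ _ 0).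
- by move=> v ->; rewrite cdot0r.
- by move=> v ->; rewrite mulmx0 cdot0r.
- move=> v [c [w [-> ->]]]; exists c.
  by rewrite mulmx0 addr0 subrr.
Qed.

(** The step length makes the new residual orthogonal to p_k, hence to
    K_(k+1).  The new direction is A-orthogonal to v in K_k because the new
    residual is orthogonal to P^-1 A v in K_(k+1), and to p_k by the choice of beta. *)
Lemma pcg_inv_step k s : pcg_r s != 0 -> pcg_inv k s ->
  pcg_inv k.+1 (pcg_step A P s).
Proof.
case: s => x r p /= r0 [/= rE Kx Kr Kp orth conj span].
rewrite (negbTE r0) !qformE.
have [[hAt hA0] [hHt hH0]] := (hA, hH).
set rho := cdot r _; set pAp := cdot p _.
have rho0 : 0 < rho := hH0 _ r0.
have Kp' : K k.+1 p.
  by rewrite -(subrK (H *m r) p); apply: krylovD => //; apply: krylovS.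
have rp : cdot r p = rho.
  by rewrite -(subrK (H *m r) p) cdotDr orth// add0r.
have p0 : p != 0.
  by apply: contraTneq rho0 => pz; rewrite -rp pz cdot0r ltxx.
have pAp0 : 0 < pAp := hA0 _ p0.
set alpha := rho / pAp; have alpha0 : 0 < alpha by rewrite divr_gt0.
set r' := r - alpha *: (A *m p).
set rho' := cdot r' _; set beta := rho' / rho.
have cdotr' v : cdot r' v = cdot r v - alpha * cdot p (A *m v).
  rewrite cdotDl -scaleNr cdotZl rmorphN /= (CrealP (gtr0_real alpha0)) mulNr.
  by rewrite cdot_herm.
have orth' v : K k.+1 v -> cdot r' v = 0.
  move=> /span[c Kv]; rewrite -(subrK (c *: p) v) cdotDr cdotZr.
  rewrite !cdotr' orth// conj// rp.
  by rewrite divfK ?gt_eqF// subrr !mulr0 addr0 subrr.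
have HrE : H *m r' = H *m r - alpha *: (H *m A *m p).
  by rewrite /r' mulmxBr -scalemxAr mulmxA.
have Kr' : K k.+2 (H *m r').
  rewrite HrE; apply: krylovB; first exact: krylovS.
  by apply: krylovZ; apply: krylovM.
split=> //=.
- by rewrite mulmxDr -scalemxAr opprD addrA -rE.
- by rewrite addrAC; apply: krylovD; [apply: krylovS|apply: krylovZ].
- by rewrite addrAC subrr add0r; apply: krylovZ.
- (* A p is, up to 1 / alpha, the difference of two residuals. *)
  have rho'0 : 0 <= rho'.
    have [r'0|/hH0/ltW//] := eqVneq r' 0.
    by rewrite /rho' r'0 mulmx0 cdot0r.
  have Hr'Ap : cdot (H *m r') (A *m p) = - (beta * pAp).
    apply: (mulfI (lt0r_neq0 alpha0)); rewrite -cdotZr.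
    have -> : alpha *: (A *m p) = r - r' by rewrite opprB addrC subrK.
    rewrite cdotDr -scaleN1r cdotZr mulN1r !cdot_herm// orth'// sub0r.
    rewrite mulrN; congr (- _); rewrite /alpha /beta -/rho'.
    by field; rewrite !gt_eqF.
  have betaR : beta^*%R = beta.
    by apply/CrealP/ger0_real; rewrite divr_ge0// ltW.
  move=> v /span[c Kv]; rewrite -(subrK (c *: p) v).
  rewrite [A *m (_ + c *: p)]mulmxDr -scalemxAr.
  set v1 := v - c *: p in Kv *.
  rewrite cdotDr cdotZr !cdotDl !cdotZl betaR conj// mulr0 addr0 -/pAp.
  rewrite Hr'Ap addNr mulr0 addr0 cdot_herm// mulmxA orth'//.
  exact: krylovM.
- (* H A p is a combination of H r, p and the new direction. *)
  move=> v [c [w [Kw ->]]]; have [a Ka] := span _ Kw.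
  exists (- (a / alpha)).
  set z := H *m (b - A *m x0) in Ka *.
  have -> : c *: z + H *m A *m w - - (a / alpha) *: (H *m r' + beta *: p)
    = (c *: z + H *m A *m (w - a *: p))
      + (a / alpha) *: (H *m r + beta *: p).
    rewrite HrE [_ *m (w - _)]mulmxBr -scalemxAr; apply/matrixP => i j.
    move: (H *m A *m w) (H *m A *m p) (H *m r) => X Y Z.
    by rewrite !mxE; field; rewrite gt_eqF.
  apply: krylovD.
    by exists c, (w - a *: p).
  by apply: krylovZ; apply: krylovD => //; apply: krylovZ.
Qed.

(** The invariant breaks off at a zero residual, where the state is frozen but
    the iterate is already exact. *)
Lemma pcg_invP k : let s := pcg A P b x0 k in
  pcg_r s = 0 /\ pcg_r s = b - A *m pcg_x s \/ pcg_inv k s.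
Proof.
elim: k => [|k]; first by right; apply: pcg_inv_init.
rewrite [pcg _ _ _ _ k.+1]iterS -/(pcg A P b x0 k) /=.
move: (pcg A P b x0 k) => s IH.
have [r0|rN0] := eqVneq (pcg_r s) 0.
  left; suff -> : pcg_step A P s = s by case: IH => [//|/pcg_inv_res].
  by move: r0; case: (s) => x r p /= ->; rewrite eqxx.
by case: IH => [[r0 _]|IH]; [rewrite r0 eqxx in rN0|right; apply: pcg_inv_step].
Qed.

(** A vector of e_0 + K_k differs from the error e_k by an element of K_k, which is
    A-orthogonal to e_k because the residual -A e_k is orthogonal to K_k. *)
Lemma pcg_optimal k x v : A *m x = b -> K k (v - (x0 - x)) ->
  hnorm A (pcg_iterate A P b x0 k - x) <= hnorm A v.
Proof.
move=> Ax Kv; have [hAt hA0] := hA.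
have qA0 w : 0 <= qform A w.
  have [->|/hA0/ltW] := eqVneq w 0; last by rewrite qformE.
  by rewrite qformE mulmx0 cdot0r.
have Re_mono (y z : R[i]) : y <= z -> complex.Re y <= complex.Re z.
  by rewrite lecE => /andP[].
rewrite /hnorm; apply: ler_wsqrtr; apply: Re_mono.
rewrite /pcg_iterate; have := pcg_invP k; move: (pcg A P b x0 k) => s /=.
set e := pcg_x s - x.
have resE : b - A *m pcg_x s = - (A *m e).
  by rewrite /e mulmxBr Ax opprB.
case=> [[-> /esym]|inv].
  rewrite resE => /eqP; rewrite oppr_eq0 => /eqP Ae.
  by rewrite qformE Ae cdot0r.
have Kd : K k (v - e).
  have -> : v - e = (v - (x0 - x)) - (pcg_x s - x0).
    by rewrite /e; apply/matrixP => i j; rewrite !mxE; ring.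
  by apply: krylovB => //; apply: pcg_inv_x inv.
have := pcg_inv_orth inv Kd; rewrite (pcg_inv_res inv) resE -scaleN1r cdotZl.
rewrite cdot_herm// => /eqP; rewrite mulf_eq0 conjC_eq0 oppr_eq0 oner_eq0 /=.
move=> /eqP ed.
rewrite -(subrK e v) !qformE; apply: energy_orth_le => //.
by rewrite -qformE qA0.
Qed.

End PCG.

(** * The convergence bound *)

Lemma ln_prod (R : realType) (I : finType) (f : I -> R) : (forall i, 0 < f i) ->
  ln (\prod_i f i) = \sum_i ln (f i).
Proof.
move=> f0.
suff [] : 0 < \prod_i f i /\ ln (\prod_i f i) = \sum_i ln (f i) by [].
elim/big_rec2: _ => [|i y x _ [x0 <-]]; first by rewrite ln1.
by rewrite mulr_gt0// lnM ?posrE.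
Qed.

Lemma hposdefE (R : realType) (n : nat) (M : 'M[R[i]]_n) :
  hposdef M -> herm_posdef M.
Proof.
move=> [/is_hermitianmxP hM M0]; split; last by move=> v /M0; rewrite qformE.
by rewrite {2}hM expr0 scale1r.
Qed.

Lemma logdet_div_pencil (R : realType) (n : nat) (A P G : 'M[R[i]]_n)
    (lam : 'I_n -> R) :
  G \in unitmx -> P = G ^t* *m G ->
  A = G ^t* *m diag_mx (\row_i (lam i)%:C) *m G -> (forall i, 0 < lam i) ->
  logdet_div A P = \sum_i logdet_term (lam i).
Proof.
move=> uG PE AE lam0.
rewrite /logdet_div (pencil_trace uG PE AE) (pencil_det uG PE AE).
under eq_bigr do rewrite mxE; under [X in complex.Re X]eq_bigr do rewrite mxE.
rewrite -rmorph_sum -rmorph_prod /= ln_prod// /logdet_term !sumrB.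
by rewrite sumr_const card_ord; lra.
Qed.

(** In the coordinates w = G v the squared A-norm is the weighted sum of the
    lam i |w_i|^2, and the i-th coordinate of the filtered vector is multiplied by
    the value at lam i of the polynomial with roots s. *)
Lemma hnorm_filter (R : realType) (n : nat) (A P G : 'M[R[i]]_n)
    (lam : 'I_n -> R) (s : seq R) (q : R) (e : 'cV[R[i]]_n) :
  G \in unitmx -> P = G ^t* *m G ->
  A = G ^t* *m diag_mx (\row_i (lam i)%:C) *m G -> (forall i, 0 < lam i) ->
  0 <= q -> (forall i, `|\prod_(mu <- s) (1 - lam i / mu)| <= q) ->
  hnorm A (foldr (fun mu v => v - mu^-1 *: (invmx P *m A *m v)) e
             [seq mu%:C | mu <- s]) <= q * hnorm A e.
Proof.
move=> uG PE AE lam0 q0 sq; set v := foldr _ _ _.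
have le_qform : qform A v <= (q ^+ 2)%:C * qform A e.
  rewrite !qformE !(pencil_energy AE) mulr_sumr; apply: ler_sum => i _.
  rewrite (pencil_filter uG PE AE) mxE big_map normrM exprMn mulrCA.
  rewrite ler_wpM2r//; first by rewrite mulr_ge0 ?ler0c ?(ltW (lam0 i)) ?exprn_ge0.
  under eq_bigr do rewrite -fmorphV -rmorphM -(rmorph1 (real_complex R)) -rmorphB.
  rewrite -rmorph_prod real_normK ?complex_real ?eqxx// -rmorphXn lecR /=.
  rewrite -(real_normK (num_real _)).
  by apply: lerXn2r; rewrite ?nnegrE.
rewrite /hnorm -{1}(ger0_norm q0) -sqrtr_sqr -sqrtrM ?sqr_ge0//.
apply: ler_wsqrtr; move: le_qform; rewrite lecE => /andP[_].
by case: (qform A e) => a c /=; rewrite mul0r subr0.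
Qed.

Theorem corollary4 (R : realType) (n : nat) (A P : 'M[R[i]]_n)
    (b x x0 : 'cV[R[i]]_n)
    (hA : hposdef A) (hP : hposdef P) (hx : A *m x = b)
    (k : nat) (k_gt0 : (0 < k)%N) (k_even : ~~ odd k)
    (hDk : 3 * logdet_div A P <= k%:R) (k_lt_n : (k < n)%N) :
  hnorm A (pcg_iterate A P b x0 k - x)
    <= (3 * logdet_div A P / k%:R) ^+ k./2 * hnorm A (x0 - x).
Proof.
have [{}hA {}hP] := (hposdefE hA, hposdefE hP).
have [G uG [d d0 [PE AE]]] := simultaneous_diag hA hP.
pose lam i := complex.Re (d 0 i).
have dE : d = \row_i (lam i)%:C.
  by apply/rowP => i; rewrite mxE RRe_real// gtr0_real.
have lam0 i : 0 < lam i by rewrite -ltcR RRe_real// gtr0_real.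
rewrite {}dE in AE.
have DE := logdet_div_pencil uG PE AE lam0.
have kE : k = k./2.*2 by rewrite -[LHS]odd_double_half (negbTE k_even).
set m := k./2 in kE *.
have m0 : (0 < m)%N by lia.
have kR : k%:R = m%:R * 2 :> R by rewrite {1}kE -muln2 natrM.
have [||s sz sq] := deflating_roots lam0 m0; first by lia.
  by rewrite -DE; lra.
rewrite -DE in sq.
have qE : 3 / 2 * (logdet_div A P / m%:R) = 3 * logdet_div A P / k%:R.
  by rewrite kR; field; rewrite pnatr_eq0 -lt0n.
rewrite {}qE in sq.
have D0 : 0 <= logdet_div A P.
  by rewrite DE; apply: sumr_ge0 => i _; apply: logdet_term_ge0.
have q0 : 0 <= (3 * logdet_div A P / k%:R) ^+ m.
  by rewrite exprn_ge0// divr_ge0// mulr_ge0.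
apply: le_trans (hnorm_filter (x0 - x) uG PE AE lam0 q0 sq).
apply: (pcg_optimal hA (invmx_herm_posdef hP)) => //.
have <- : size [seq mu%:C | mu <- s] = k by rewrite size_map sz.
apply: krylov_filter.
by rewrite -mulmxA -mulmxN mulmxBr hx opprB.
Qed.
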